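(* Let $M$ be a set of probability distributions on a measurable space $(\mathcal{Y},\mathcal{B})$ with common support, containing more than one member, and let $R$ be a pointwise assessment criterion for estimators with values in $M$. Then no estimator is uniformly $R$-optimal over $M$; that is, there is no estimator $\hat m^{*}:\mathcal{Y}\to M$ such that $R(\hat m^{*},m)\le R(\hat m,m)$ for every estimator $\hat m:\mathcal{Y}\to M$ and every $m\in M$.
   Context: Common support: all members of $M$ are given by densities with respect to a common dominating measure $\mu$ on $(\mathcal{Y},\mathcal{B})$ (counting measure if $\mathcal{Y}$ is countable), with the same support $\mathcal{Y}$; in particular any two members of $M$ are mutually absolutely continuous. No manifold or smooth structure on $M$ is assumed. An estimator is a function $\hat m:\mathcal{Y}\to M$ such that the event $\{y:\hat m(y)=m\}$ belongs to $\mathcal{B}$ for every $m\in M$. All such functions are allowed, including the constant estimators $\hat m\equiv m_0$ with $m_0\in M$. An assessment criterion $R$ is called pointwise if it assigns to each estimator $\hat m$ and each single distribution $m\in M$ a risk $R(\hat m,m)\ge 0$ computed from the sampling distribution of $\hat m$ under $m$ alone (that is, depending only on $m$ and on the distribution of $\hat m(Y)$ when $Y\sim m$), with $R(\hat m,m)=0$ if and only if $\hat m=m$ almost surely under $m$. *)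

(* Defs.v *)
From HB Require Import structures.
From mathcomp Require Import all_boot all_order all_algebra.
From mathcomp Require Import all_classical all_reals all_analysis.

Set Implicit Arguments.
Unset Strict Implicit.
Unset Printing Implicit Defensive.

Import Order.TTheory GRing.Theory Num.Theory.

Local Open Scope classical_set_scope.
Local Open Scope ring_scope.
Local Open Scope ereal_scope.

(* A library [probability] is a function on all subsets of [Y], with
   unconstrained values off the sigma-algebra, so Leibniz equality of such
   functions is finer than equality of distributions. Normalizing the irrelevant
   values to 0 makes the two coincide: [prob_distribution_ext] shows that equality is
   equality on measurable sets, [prob_distribution_exists] that every probability
   measure is still represented. *)
Record prob_distribution d (Y : measurableType d) (K : realType) := ProbDistribution {
  dprob :> probability Y K ;
  dprob_nonmeasurable : forall A, ~ measurable A -> dprob A = 0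
}.

Section distribution_lemmas.
Context d (Y : measurableType d) (K : realType).

Lemma prob_distribution_ext (m m' : prob_distribution Y K) :
  (forall A, measurable A -> m A = m' A) -> m = m'.
Proof.
case: m m' => [P hP] [Q hQ] /= PQ.
have : P = Q.
  have : P = Q :> (set Y -> \bar K).
    apply/funext => A; have [mA|nmA] := pselect (measurable A); first exact: PQ.
    by rewrite hP// hQ.
  case: P Q {hP hQ PQ} => [P cP] [Q cQ] /= PQ.
  subst Q; congr Probability.Pack.
  case: cP => [[P1 P2] [P3] [P4] [P5] [P6] [P7] [P8]].
  case: cQ => [[Q1 Q2] [Q3] [Q4] [Q5] [Q6] [Q7] [Q8]].
  have E1 : Q1 = P1 by exact: Prop_irrelevance.
  have E2 : Q2 = P2 by exact: Prop_irrelevance.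
  subst Q1 Q2.
  have E3 : Q3 = P3 by exact: Prop_irrelevance.
  have E4 : Q4 = P4 by exact: Prop_irrelevance.
  have E5 : Q5 = P5 by exact: Prop_irrelevance.
  have E6 : Q6 = P6 by exact: Prop_irrelevance.
  have E7 : Q7 = P7 by exact: Prop_irrelevance.
  have E8 : Q8 = P8 by exact: Prop_irrelevance.
  by rewrite E3 E4 E5 E6 E7 E8.
by move=> E; subst Q; congr ProbDistribution; exact: Prop_irrelevance.
Qed.

Variable P : probability Y K.

Let restr (A : set Y) : \bar K := if `[< measurable A >] then P A else 0.

Let restrE A : measurable A -> restr A = P A.
Proof. by move=> mA; rewrite /restr asboolT. Qed.

Let restr0 : restr set0 = 0.
Proof. by rewrite restrE// measure0. Qed.

Let restr_ge0 A : 0 <= restr A.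
Proof. by rewrite /restr; case: ifP. Qed.

Let restr_sigma_additive : semi_sigma_additive restr.
Proof.
move=> F mF tF mUF; rewrite restrE//.
under eq_fun do under eq_bigr do rewrite restrE//.
exact: measure_semi_sigma_additive.
Qed.

HB.instance Definition _ := isMeasure.Build _ _ _ restr
  restr0 restr_ge0 restr_sigma_additive.

Let restr_setT : restr setT = 1.
Proof. by rewrite restrE// probability_setT. Qed.

HB.instance Definition _ := Measure_isProbability.Build _ _ _ restr restr_setT.

Lemma prob_distribution_exists :
  exists m : prob_distribution Y K, forall A, measurable A -> m A = P A.
Proof.
have h A : ~ measurable A -> (restr : probability Y K) A = 0.
  by move=> nmA; rewrite /= /restr asboolF.
by exists (ProbDistribution h) => A mA; exact: restrE.
Qed.

End distribution_lemmas.

Section definitions.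
Context d (Y : measurableType d) (K : realType).

Definition is_density (mu : {measure set Y -> \bar K}) (m : prob_distribution Y K)
    (p : Y -> K) : Prop :=
  [/\ measurable_fun setT p,
      forall y, (0 <= p y)%R
    & forall A, measurable A -> m A = \int[mu]_(y in A) (p y)%:E].

(* The support of a density is the set where it is positive; that it be all of
   [Y] is asked of one version of the density, as densities are only determined
   almost everywhere. *)
Definition common_support (M : set (prob_distribution Y K)) : Prop :=
  exists mu : {measure set Y -> \bar K},
    (countable [set: Y] -> forall A, measurable A -> mu A = counting A) /\
    forall m, M m ->
      exists p, is_density mu m p /\ [set y | (0 < p y)%R] = [set: Y].

Record estimator (M : set (prob_distribution Y K)) := Estimator {
  estimate :> Y -> M ;
  estimator_event : forall m : M, measurable [set y | estimate y = m]
}.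

(* [M] carries no sigma-algebra, so the distribution of [e] under [m] is the
   image of [m] on the largest one making [e] measurable, namely
   [image_set_system setT e measurable]. It determines the law of [e] on any
   coarser sigma-algebra, in particular on the one generated by singletons. *)
Definition same_sampling_distribution (M : set (prob_distribution Y K)) (m : M)
    (e e' : estimator M) : Prop :=
  image_set_system setT e measurable = image_set_system setT e' measurable /\
  forall A : set M, image_set_system setT e measurable A ->
    val m (e @^-1` A) = val m (e' @^-1` A).

(* Risks may be infinite. *)
Definition pointwise_criterion (M : set (prob_distribution Y K))
    (risk : estimator M -> M -> \bar K) : Prop :=
  [/\ forall e m, 0 <= risk e m,
      forall e e' m, same_sampling_distribution m e e' -> risk e m = risk e' m
    & forall e m, risk e m = 0 <-> {ae val m, forall y, e y = m}].

Definition uniformly_optimal (M : set (prob_distribution Y K))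
    (risk : estimator M -> M -> \bar K) (e : estimator M) : Prop :=
  forall (e' : estimator M) (m : M), risk e m <= risk e' m.

End definitions.

(* Main.v *)
Require Import Defs.
From mathcomp Require Import all_boot all_order all_algebra.
From mathcomp Require Import all_classical all_reals all_analysis.
From mathcomp Require Import measurable_realfun.

Local Open Scope classical_set_scope.

(** A uniformly optimal estimator would have to be perfect everywhere. For each
[m] in [M], the constant estimator with value [m] has risk zero at [m], so the
optimal estimator has risk zero there too, and therefore equals [m] almost
surely under [m] ([optimal_estimator_ae_correct]).

This is impossible for two different members [m1] and [m2]. A common support
makes them mutually absolutely continuous ([common_support_dominates]), so what
holds almost surely under [m1] also holds almost surely under [m2]. Under [m2]
the estimator then equals both [m1] and [m2] almost surely, so the whole space
is a null set of [m2], although its probability is one. *)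

(** An integral of a positive function vanishes only over null sets. *)
Lemma positive_density_dominates {d} {Y : measurableType d} {K : realType}
    {mu : {measure set Y -> \bar K}%R} {m : prob_distribution Y K} {p : Y -> K} :
  is_density mu m p -> [set y | (0 < p y)%R] = [set: Y] -> mu `<< m.
Proof.
move=> [mp p_ge0 mE] p_gt0; apply/null_content_dominatesP => A mA mA0.
have int0 := etrans (esym (mE A mA)) mA0.
apply/(negligibleP mu mA).
have mpA : measurable_fun A (fun y => (p y)%:E).
  by apply/measurable_EFinP; exact: measurable_funTS.
have /(ae_eq_integral_abs mu mA mpA) : (\int[mu]_(y in A) `|(p y)%:E| = 0)%E.
  by rewrite -int0; apply: eq_integral => y _; rewrite gee0_abs// lee_fin.
apply: negligibleS => y Ay /= /(_ Ay) [py0].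
have : [set y | (0 < p y)%R] y by rewrite p_gt0.
by rewrite /= py0 Order.POrderTheory.ltxx.
Qed.

Lemma density_dominated {d} {Y : measurableType d} {K : realType}
    {mu : {measure set Y -> \bar K}%R} {m : prob_distribution Y K} {p : Y -> K} :
  is_density mu m p -> m `<< mu.
Proof.
move=> [mp _ mE]; apply/null_content_dominatesP => A mA muA0.
apply: (etrans (mE A mA)); apply: null_set_integral => //.
by apply/measurable_EFinP; exact: measurable_funTS.
Qed.

(** The reference measure mediates: a null set of [m1] is null for [mu] because
the density of [m1] is positive, hence null for [m2], which has a density too. *)
Lemma common_support_dominates {d} {Y : measurableType d} {K : realType}
    {M : set (prob_distribution Y K)} (m1 m2 : M) :
  common_support M -> val m2 `<< val m1.
Proof.
move=> [mu [_ Mmu]].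
have [p1 [d1 p1_gt0]] := Mmu _ (set_valP m1).
have [p2 [d2 _]] := Mmu _ (set_valP m2).
exact: null_dominates_trans (density_dominated d2)
  (positive_density_dominates d1 p1_gt0).
Qed.

Lemma constant_estimator_event {d} {Y : measurableType d} {K : realType}
    {M : set (prob_distribution Y K)} (m0 m : M) :
  measurable [set y : Y | m0 = m].
Proof.
have [->|neq] := pselect (m0 = m).
  by rewrite (_ : mkset _ = setT)//; apply/seteqP; split.
by rewrite (_ : mkset _ = set0)//; apply/seteqP; split=> // y /neq.
Qed.

Definition constant_estimator {d} {Y : measurableType d} {K : realType}
    {M : set (prob_distribution Y K)} (m0 : M) : estimator M :=
  Estimator (constant_estimator_event m0).

(** The constant estimator with value [m] competes with risk zero at [m], and
zero is the least possible risk. *)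
Lemma optimal_estimator_ae_correct {d} {Y : measurableType d} {K : realType}
    {M : set (prob_distribution Y K)} {risk : estimator M -> M -> \bar K}
    {e : estimator M} (m : M) :
  pointwise_criterion risk -> uniformly_optimal risk e ->
  {ae val m, forall y, e y = m}.
Proof.
move=> [risk_ge0 _ risk0P] e_opt; apply/risk0P.
have const0 : risk (constant_estimator m) m = 0%E.
  by apply/risk0P; exact: aeW.
by apply/eqP; rewrite Order.POrderTheory.eq_le risk_ge0 andbT -const0 e_opt.
Qed.

Theorem lemma1 (d : measure_display) (Y : measurableType d) (K : realType)
    (M : set (prob_distribution Y K))
    (M_support : common_support M)
    (M_many : exists m1 m2 : M, m1 <> m2)
    (risk : estimator M -> M -> \bar K)
    (risk_pointwise : pointwise_criterion risk) :
  ~ exists e : estimator M, uniformly_optimal risk e.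
Proof.
move=> [e e_opt]; have [m1 [m2 m1_neq_m2]] := M_many.
have ae_correct m := optimal_estimator_ae_correct m risk_pointwise e_opt.
have e_m1 : {ae val m2, forall y, e y = m1}.
  have : ae_eq (val m1) setT e (cst m1).
    by apply: filterS (ae_correct m1) => y ey _.
  have m2_m1 := common_support_dominates m1 m2 M_support.
  move/(null_dominates_ae_eq measurableT m2_m1).
  by apply: filterS => y /(_ I).
have absurd_ae : {ae val m2, forall y : Y, False}.
  by apply: filterS2 e_m1 (ae_correct m2) => y -> /m1_neq_m2.
have /(negligibleP _ measurableT) : (val m2).-negligible [set: Y].
  by apply: negligibleS absurd_ae => y _ [].
by move=> /(etrans (esym (probability_setT (val m2)))) /eqP; rewrite onee_eq0.
Qed.
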